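(* Let $K$ be a field, let $r,s$ be non negative integers, let $R=K[a,b,x_1,\dots,x_r,y_1,\dots,y_s]$, and let $I(T_{r,s})$ be the ideal of $R$ generated by the ordered sequence of monomials $$f=ab,\ g_1=ax_1,\ \dots,\ g_r=ax_r,\ h_1=by_1,\ \dots,\ h_s=by_s$$ (the edge ideal of the double-star graph $T_{r,s}$). The Lyubeznik resolution associated with this ordered sequence is a minimal free resolution of $R/I(T_{r,s})$.
   Context: The double-star graph $T_{r,s}$ is the tree on the distinct vertices $a,b,x_1,\dots,x_r,y_1,\dots,y_s$ with edges $\{a,b\}$, $\{a,x_i\}$ ($1\le i\le r$), $\{b,y_i\}$ ($1\le i\le s$). Lyubeznik resolution: let $f_1,\dots,f_m$ be an ordered sequence of monomials of a polynomial ring $R$ over a field, generating the ideal $I$. For a sequence $(f_{i_1},\dots,f_{i_t})$ with $1\le i_1<\cdots<i_t\le m$, the symbol $u(f_{i_1},\dots,f_{i_t})$ is called $L$-admissible of dimension $t$ if $f_q$ does not divide $\mathrm{lcm}(f_{i_h},f_{i_{h+1}},\dots,f_{i_t})$ for all $h<t$ and $q<i_h$. Set $L^0=R$ and, for $t=1,\dots,m$, let $L^t$ be the free $R$-module generated by all $L$-admissible symbols of dimension $t$. Define $d_t:L^t\to L^{t-1}$ by $$d_t(u(f_{i_1},\dots,f_{i_t}))=\sum_{j=1}^t(-1)^{j+1}\frac{\mathrm{lcm}(f_{i_1},\dots,f_{i_t})}{\mathrm{lcm}(f_{i_1},\dots,\widehat{f_{i_j}},\dots,f_{i_t})}\,u(f_{i_1},\dots,\widehat{f_{i_j}},\dots,f_{i_t}),$$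 where the hat means omission, the lcm of the empty sequence is $1$, and the empty symbol is the generator $1$ of $L^0=R$. The complex $0\to L^m\to L^{m-1}\to\cdots\to L^0\to 0$ with differentials $d_t$ is the Lyubeznik resolution associated with $f_1,\dots,f_m$. *)

(* Defs.v *)
From HB Require Import structures.
From mathcomp Require Import all_boot all_order all_algebra.
From mathcomp Require Import zify.
From mathcomp Require Import boolp.
From mathcomp Require Import mpoly.

Set Implicit Arguments.
Unset Strict Implicit.
Unset Printing Implicit Defensive.

Import GRing.Theory.
Import Quotient.
Local Open Scope ring_scope.
Local Open Scope quotient_scope.

Section GeneratedIdeal.
Variables (R : comNzRingType) (J : finType) (g : J -> R).

Definition ideal_gen : {pred R} :=
  fun p => `[< exists c : J -> R, p = \sum_i c i * g i >].

Lemma ideal_genP p :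
  reflect (exists c : J -> R, p = \sum_i c i * g i) (p \in ideal_gen).
Proof. exact: asboolP. Qed.

Fact ideal_gen_zmod_closed : zmod_closed ideal_gen.
Proof.
split=> [|p q /ideal_genP[c ->] /ideal_genP[e ->]]; apply/ideal_genP.
  by exists (fun=> 0); rewrite big1 // => i _; rewrite mul0r.
exists (fun i => c i - e i); rewrite -sumrB.
by apply: eq_bigr => i _; rewrite mulrBl.
Qed.

HB.instance Definition _ :=
  GRing.isZmodClosed.Build R ideal_gen ideal_gen_zmod_closed.

Fact ideal_gen_mull a p : p \in ideal_gen -> a * p \in ideal_gen.
Proof.
move=> /ideal_genP[c ->]; apply/ideal_genP; exists (fun i => a * c i).
by rewrite mulr_sumr; apply: eq_bigr => i _; rewrite mulrA.
Qed.

(* R / (g), as an R-module.  The library's quotient ring is restricted to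
   proper ideals, so only its additive group is reused here. *)
Definition cyclic_mod : Type := {quot ideal_gen}.
HB.instance Definition _ := GRing.Zmodule.on cyclic_mod.

Definition class_of (p : R) : cyclic_mod := \pi_({quot ideal_gen}) p.

Lemma class_of_eq p q : class_of p = class_of q <-> p - q \in ideal_gen.
Proof.
rewrite idealrBE; split=> [h|/eqP h]; last exact: h.
by apply/eqP; exact: h.
Qed.

Fact class_of_is_additive : zmod_morphism class_of.
Proof. by move=> p q; rewrite /class_of raddfB. Qed.

Lemma class_of_repr (x : cyclic_mod) : class_of (repr x) = x.
Proof. exact: reprK. Qed.

Definition cyclic_scale (a : R) (x : cyclic_mod) : cyclic_mod :=
  class_of (a * repr x).

Fact cyclic_scaleE a p : cyclic_scale a (class_of p) = class_of (a * p).
Proof.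
apply/class_of_eq; rewrite -mulrBr; apply: ideal_gen_mull.
by apply/class_of_eq; rewrite class_of_repr.
Qed.

Fact cyclic_scaleA a b x :
  cyclic_scale a (cyclic_scale b x) = cyclic_scale (a * b) x.
Proof. by rewrite -(class_of_repr x) !cyclic_scaleE mulrA. Qed.

Fact cyclic_scale1 : left_id 1 cyclic_scale.
Proof. by move=> x; rewrite -(class_of_repr x) cyclic_scaleE mul1r. Qed.

Fact class_ofD p q : class_of (p + q) = class_of p + class_of q.
Proof. by rewrite /class_of raddfD. Qed.

Fact cyclic_scaleDr : right_distributive cyclic_scale +%R.
Proof.
move=> a x y; rewrite -(class_of_repr x) -(class_of_repr y) -class_ofD.
by rewrite !cyclic_scaleE mulrDr class_ofD.
Qed.

Fact cyclic_scaleDl x : {morph cyclic_scale^~ x : a b / a + b}.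
Proof.
by move=> a b /=; rewrite -(class_of_repr x) !cyclic_scaleE mulrDl class_ofD.
Qed.

HB.instance Definition _ := GRing.Zmodule_isLmodule.Build R cyclic_mod
  cyclic_scaleA cyclic_scale1 cyclic_scaleDr cyclic_scaleDl.

Lemma class_ofZ a p : class_of (a * p) = a *: class_of p.
Proof. by rewrite -[RHS]/(cyclic_scale _ _) cyclic_scaleE. Qed.

End GeneratedIdeal.

Definition in_ideal_smul (R : comNzRingType) (N : lmodType R) (J : {pred R})
    (x : N) : Prop :=
  exists (k : nat) (a : 'I_k -> R) (v : 'I_k -> N),
    (forall i, a i \in J) /\ x = \sum_(i < k) a i *: v i.

Section FreeResolution.
Variable R : comNzRingType.

(* The module in homological degree t is free with basis [cells t]; [diff t]
   goes from degree t + 1 to degree t. *)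
Record free_complex := FreeComplex {
  cells : nat -> finType;
  diff : forall t, {linear {ffun cells t.+1 -> R^o} -> {ffun cells t -> R^o}}
}.

Record free_resolution (F : free_complex) (M : lmodType R)
    (eps : {linear {ffun cells F 0 -> R^o} -> M}) : Prop := FreeResolution {
  aug_surjective : forall y, exists x, eps x = y;
  exact_aug : forall x, eps x = 0 <-> exists y, diff F 0 y = x;
  exact_diff : forall t x, diff F t x = 0 <-> exists y, diff F t.+1 y = x
}.

Definition minimal_wrt (mm : {pred R}) (F : free_complex) : Prop :=
  forall t x, in_ideal_smul mm (diff F t x).

Definition minimal_free_resolution (mm : {pred R}) (F : free_complex)
    (M : lmodType R) (eps : {linear {ffun cells F 0 -> R^o} -> M}) : Prop :=
  free_resolution eps /\ minimal_wrt mm F.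

End FreeResolution.

Definition irrelevant_ideal (K : fieldType) (n : nat) : {pred {mpoly K[n]}} :=
  ideal_gen (fun i : 'I_n => 'X_i : {mpoly K[n]}).
Arguments irrelevant_ideal : clear implicits.

Fact mlcmA n : associative (@mlcm n).
Proof. by move=> p q o; apply/mnmP=> i; rewrite /mlcm !mnmE maxnA. Qed.

HB.instance Definition _ n := Monoid.isComLaw.Build 'X_{1..n} 0%MM (@mlcm n)
  (@mlcmA n) (@mlcmC n) (@mlc0m n).

(* A monomial is given by its exponent vector; divisibility is then the
   componentwise order (_ <= _)%MM.  Positions in sequences start from 0. *)
Section Lyubeznik.
Variables (K : fieldType) (n m : nat) (f : m.-tuple 'X_{1..n}).
Local Notation R := {mpoly K[n]}.

Definition lcm_from t (u : t.-tuple 'I_m) (h : nat) : 'X_{1..n} :=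
  \big[@mlcm n/0%MM]_(k < t | (h <= k)%N) tnth f (tnth u k).

Definition increasing t (u : t.-tuple 'I_m) : bool :=
  [forall h : 'I_t, forall k : 'I_t, (h < k)%N ==> (tnth u h < tnth u k)%N].

(* No condition is imposed at the last position h = t - 1. *)
Definition L_admissible t (u : t.-tuple 'I_m) : bool :=
  [forall h : 'I_t, (h.+1 < t)%N ==>
    [forall q : 'I_m, (q < tnth u h)%N ==>
      ~~ (tnth f q <= lcm_from u h)%MM]].

Definition L_symbol (t : nat) : finType :=
  {u : t.-tuple 'I_m | increasing u && L_admissible u}.

Local Notation L_module t := {ffun L_symbol t -> R^o}.

Definition symbol_lcm t (u : L_symbol t) : 'X_{1..n} := lcm_from (val u) 0.

Definition omit t (j : 'I_t.+1) (u : t.+1.-tuple 'I_m) : t.-tuple 'I_m :=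
  [tuple tnth u (lift j k) | k < t].

Lemma lcm_fromP t (u : t.-tuple 'I_m) h (p : 'X_{1..n}) :
  reflect (forall k : 'I_t, (h <= k)%N -> (tnth f (tnth u k) <= p)%MM)
          (lcm_from u h <= p)%MM.
Proof.
rewrite /lcm_from; apply: (iffP idP) => [le_p k hk|le_p].
  by move: le_p; rewrite (bigD1 k) //= lem_mlcm => /andP[].
elim/big_rec: _ => [|k q hk IH]; first by apply/forallP=> i; rewrite mnmE.
by rewrite lem_mlcm IH andbT le_p.
Qed.

Fact omit_is_symbol t (j : 'I_t.+1) (u : t.+1.-tuple 'I_m) :
  increasing u && L_admissible u ->
  increasing (omit j u) && L_admissible (omit j u).
Proof.
have liftS (h k : 'I_t) : (h < k)%N -> (lift j h < lift j k)%N.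
  by rewrite /= /bump; case: (leqP j h); case: (leqP j k) => *; lia.
have liftSW (h k : 'I_t) : (h <= k)%N -> (lift j h <= lift j k)%N.
  by rewrite /= /bump; case: (leqP j h); case: (leqP j k) => *; lia.
move=> /andP[/forallP inc /forallP adm]; apply/andP; split.
  apply/forallP=> h; apply/forallP=> k; apply/implyP=> hk.
  rewrite !tnth_mktuple; have /forallP/(_ (lift j k)) := inc (lift j h).
  by move=> /implyP; apply; apply: liftS.
apply/forallP=> h; apply/implyP=> ht; apply/forallP=> q; apply/implyP.
rewrite tnth_mktuple => qh.
have lt_ht : ((lift j h).+1 < t.+1)%N.
  by rewrite /= /bump; case: (leqP j h) => *; lia.
have /forallP/(_ q)/implyP/(_ qh) := implyP (adm (lift j h)) lt_ht.
apply: contra => /lepm_trans; apply; apply/lcm_fromP => k hk.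
rewrite tnth_mktuple; have /lcm_fromP := lepm_refl (lcm_from u (lift j h)).
by apply; apply: liftSW.
Qed.

Definition face t (j : 'I_t.+1) (u : L_symbol t.+1) : L_symbol t :=
  exist _ (omit j (val u)) (omit_is_symbol j (valP u)).

Definition basis_elt t (u : L_symbol t) : L_module t :=
  [ffun v => (v == u)%:R : R^o].

(* The subtraction of exponent vectors is exact, the lcm of a face dividing
   the lcm of the symbol. *)
Definition diff_symbol t (u : L_symbol t.+1) : L_module t :=
  \sum_(j < t.+1)
    ((-1) ^+ j * 'X_[symbol_lcm u - symbol_lcm (face j u)])
      *: basis_elt (face j u).

Definition L_diff t (x : L_module t.+1) : L_module t :=
  \sum_(u : L_symbol t.+1) (x u : R) *: diff_symbol u.

Fact L_diff_is_linear t : linear (@L_diff t).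
Proof.
move=> a x y; rewrite /L_diff scaler_sumr -big_split /=.
by apply: eq_bigr => u _; rewrite !ffunE scalerDl scalerA.
Qed.

HB.instance Definition _ t := GRing.isLinear.Build R (L_module t.+1)
  (L_module t) *:%R (@L_diff t) (@L_diff_is_linear t).

Definition monomial_quotient : lmodType R :=
  cyclic_mod (fun i : 'I_m => 'X_[tnth f i] : R).

Fact empty_is_symbol :
  increasing ([tuple] : 0.-tuple 'I_m) && L_admissible ([tuple] : 0.-tuple 'I_m).
Proof. by apply/andP; split; apply/forallP => -[]. Qed.

Definition empty_symbol : L_symbol 0 := exist _ [tuple] empty_is_symbol.

(* L_module 0 is R, with basis the empty symbol; the augmentation is the
   canonical projection of R onto its quotient. *)
Definition L_aug (x : L_module 0) : monomial_quotient :=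
  class_of (fun i : 'I_m => 'X_[tnth f i] : R) (x empty_symbol).

Fact L_aug_is_linear : linear L_aug.
Proof. by move=> a x y; rewrite /L_aug !ffunE class_ofD class_ofZ. Qed.

HB.instance Definition _ := GRing.isLinear.Build R (L_module 0)
  monomial_quotient *:%R L_aug L_aug_is_linear.

Definition Lyubeznik_complex : free_complex R :=
  {| cells := L_symbol; diff := fun t => @L_diff t |}.

Definition Lyubeznik_aug : {linear L_module 0 -> monomial_quotient} := L_aug.

End Lyubeznik.

Section DoubleStar.
Variables r s : nat.

Definition var_a : 'I_(2 + r + s) := lshift s (lshift r ord0).
Definition var_b : 'I_(2 + r + s) := lshift s (lshift r ord_max).
Definition var_x (i : 'I_r) : 'I_(2 + r + s) := lshift s (rshift 2 i).
Definition var_y (i : 'I_s) : 'I_(2 + r + s) := rshift (2 + r) i.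

Definition double_star_edges : (1 + r + s).-tuple 'X_{1..2 + r + s} :=
  [tuple of [:: U_(var_a) + U_(var_b)]%MM
         ++ [tuple (U_(var_a) + U_(var_x i))%MM | i < r]
         ++ [tuple (U_(var_b) + U_(var_y i))%MM | i < s]].

End DoubleStar.

(* Main.v *)
From HB Require Import structures.
Require Import Defs.
From mathcomp Require Import all_boot all_order all_algebra.
From mathcomp Require Import zify.
From mathcomp Require Import ssrcomplements mpoly.

(** Exactness holds for every sequence of monomials, and only minimality uses
    the double star.

    Exactness.  The complex is graded by monomials: in multidegree [a] it is
    spanned over K by the elements X^(a - lcm u) u ([strand_elt a u]), u ranging
    over the symbols whose lcm divides X^a, and there the differential is a
    simplicial boundary, [L_diff_strand].  If some generator divides X^a, let
    [q] be the first one.  Prepending [q] to a symbol of the strand keeps it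
    admissible, since nothing before [q] divides X^a; so the strand is a cone
    with apex [q], and prepending [q] (or 0 if [q] is already the head) is a
    contracting homotopy.  All these cones together make up one K-linear map
    [homotopy] with d h + h d = id in positive degrees ([homotopyP]).  This gives
    half of the exactness.

    The other half, d d = 0, also follows from the homotopy, without the usual
    cancellation of pairs of faces.  Admissibility says that the head of a
    symbol u with at least two entries is the first divisor of lcm u, so u is
    h v for a v in the strand of lcm u ([basis_elt_homotopy]).  Then
    d d h v = d (v - h d v) = d v - (d v - h d d v) = h d d v, which is 0 by
    induction on the degree.

    Minimality.  The coefficients of d are, up to sign, quotients of the lcm of
    a symbol by the lcm of a face; such a quotient is not 1 as soon as no
    generator of a symbol divides the lcm of the others.  In the double star, a
    leaf edge is the only generator that contains its leaf.  If ab occurs, it is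
    the head of its symbol, and it divides none of the other generators; it
    does not divide the lcm of two or more of them either, as the symbol is
    admissible at its second position. *)

Set Implicit Arguments.
Unset Strict Implicit.
Unset Printing Implicit Defensive.

Import GRing.Theory.
Local Open Scope ring_scope.

(** * Linear extension from monomials *)

Section MonomialExtension.
Variables (K : fieldType) (n : nat) (V : lmodType {mpoly K[n]}).
Variable F : 'X_{1..n} -> V.

Definition monomial_ext (p : {mpoly K[n]}) : V :=
  \sum_(m <- msupp p) (p@_m)%:MP *: F m.

(** A common bound on the degrees turns the supports of two polynomials, over
    which their extensions are sums, into one and the same range; additivity is
    then a termwise fact. *)
Lemma monomial_ext_bound k p : (msize p <= k)%N ->
  monomial_ext p = \sum_(m : 'X_{1..n < k}) (p@_m)%:MP *: F m.
Proof.
move=> le_pk; rewrite /monomial_ext (big_mksub 'X_{1..n < k}) ?msupp_uniq //=.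
  rewrite big_rmcond //= => i /memN_msupp_eq0 ->.
  by rewrite mpolyC0 scale0r.
by move=> x /msize_mdeg_lt /leq_trans; apply.
Qed.

Lemma monomial_ext_is_additive : zmod_morphism monomial_ext.
Proof.
move=> p q; pose k := maxn (maxn (msize p) (msize q)) (msize (p - q)).
have [kp kq kpq] : [/\ msize p <= k, msize q <= k & msize (p - q) <= k]%N.
  by rewrite /k; split; lia.
rewrite !(@monomial_ext_bound k) // -sumrB; apply: eq_bigr => m _.
by rewrite mcoeffB mpolyCB scalerBl.
Qed.

HB.instance Definition _ := GRing.isZmodMorphism.Build {mpoly K[n]} V
  monomial_ext monomial_ext_is_additive.

Lemma monomial_extX (c : K) m : monomial_ext (c%:MP * 'X_[m]) = c%:MP *: F m.
Proof.
rewrite /monomial_ext mul_mpolyC; have [->|c0] := eqVneq c 0.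
  by rewrite scale0r msupp0 big_nil mpolyC0 scale0r.
rewrite (perm_big _ (msuppZ _ c0)) msuppX big_seq1.
by rewrite mcoeffZ mcoeffX eqxx mulr1.
Qed.

End MonomialExtension.

Lemma mem_ideal_gen (R : comNzRingType) (J : finType) (g : J -> R) i :
  g i \in ideal_gen g.
Proof.
apply/ideal_genP; exists (fun j => (j == i)%:R).
rewrite (bigD1 i) //= eqxx mul1r big1 ?addr0 // => j ji.
by rewrite (negbTE ji) mul0r.
Qed.

(** * Multigraded strands *)

Section Strands.
Variables (K : fieldType) (n m : nat) (f : m.-tuple 'X_{1..n}).
Local Notation R := {mpoly K[n]}.
Local Notation L t := {ffun L_symbol f t -> R^o}.
Implicit Types (a : 'X_{1..n}) (q : 'I_m).

Lemma symbol_lcmP t (u : L_symbol f t) a :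
  reflect (forall k, (tnth f (tnth (val u) k) <= a)%MM) (symbol_lcm u <= a)%MM.
Proof.
by apply: (iffP (lcm_fromP _ _ _ _)) => h k; [apply: h|move=> _; apply: h].
Qed.

Lemma symbol_lcm_avoid t (u : L_symbol f t) v :
  (forall k, tnth f (tnth (val u) k) v = 0%N) -> symbol_lcm u v = 0%N.
Proof.
move=> fv; rewrite /symbol_lcm /lcm_from; elim/big_rec: _ => [|k p _ pv].
  exact: mnm0E.
by rewrite /mlcm mnmE pv fv.
Qed.

Lemma symbol_lcm_face t j (u : L_symbol f t.+1) :
  (symbol_lcm (face j u) <= symbol_lcm u)%MM.
Proof.
apply/symbol_lcmP => k; rewrite /= tnth_mktuple.
exact/symbol_lcmP/lepm_refl.
Qed.

Lemma symbol0_eq (u v : L_symbol f 0) : u = v.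
Proof. by apply: val_inj; apply: eq_from_tnth => -[]. Qed.

(** The exponent subtraction is truncated, so this is the multiple of [u] in
    multidegree [a] only when [symbol_lcm u] divides [a]. *)
Definition strand_elt t a (u : L_symbol f t) : L t :=
  'X_[a - symbol_lcm u] *: basis_elt K u.

Lemma L_diff_basis t (u : L_symbol f t.+1) :
  L_diff (basis_elt K u) = diff_symbol K u.
Proof.
rewrite /L_diff (bigD1 u) //= ffunE eqxx scale1r big1 ?addr0 // => v vu.
by rewrite ffunE (negbTE vu) scale0r.
Qed.

Lemma L_diffD t (x y : L t.+1) : L_diff (x + y) = L_diff x + L_diff y.
Proof. exact: linearD. Qed.

Lemma L_diffB t (x y : L t.+1) : L_diff (x - y) = L_diff x - L_diff y.
Proof. exact: linearB. Qed.

Lemma L_diffZ t (p : R) (x : L t.+1) : L_diff (p *: x) = p *: L_diff x.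
Proof. exact: linearZ. Qed.

Lemma L_diff_sum t (I : finType) (x : I -> L t.+1) :
  L_diff (\sum_i x i) = \sum_i L_diff (x i).
Proof. exact: linear_sum. Qed.

(** The coefficients X^(a - lcm u) and X^(lcm u - lcm (face j u)) multiply to
    X^(a - lcm (face j u)), so that only the signs are left. *)
Lemma L_diff_strand t a (u : L_symbol f t.+1) : (symbol_lcm u <= a)%MM ->
  L_diff (strand_elt a u)
    = \sum_(j < t.+1) (-1) ^+ j *: strand_elt a (face j u).
Proof.
move=> ua; rewrite /strand_elt linearZ /= L_diff_basis /diff_symbol scaler_sumr.
apply: eq_bigr => j _; rewrite !scalerA; congr (_ *: _).
rewrite mulrCA -mpolyXD; congr (_ * 'X_[_]).
apply/mnmP => i; rewrite !(mnmDE, mnmBE).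
move/mnm_lepP/(_ i): ua; move/mnm_lepP/(_ i): (symbol_lcm_face j u); lia.
Qed.

Lemma L_module_sum t (x : L t) : x = \sum_u (x u : R) *: basis_elt K u.
Proof.
apply/ffunP => v; rewrite sum_ffunE (bigD1 v) //= big1 => [|w wv].
  by rewrite addr0 !ffunE eqxx [_ *: _]mulr1.
by rewrite !ffunE eq_sym (negbTE wv) [_ *: _]mulr0.
Qed.

(** The coefficient of [u] is a sum of terms c X^p, and c X^p u lies in
    multidegree p + lcm u. *)
Lemma strand_ind t (P : L t -> Prop) :
    P 0 -> (forall x y, P x -> P y -> P (x + y)) ->
    (forall (c : K) a u, (symbol_lcm u <= a)%MM ->
       P (c%:MP *: strand_elt a u)) ->
  forall x, P x.
Proof.
move=> P0 PD Pe x; rewrite (L_module_sum x).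
apply: (big_ind P) => // u _; rewrite [x u]mpolyE scaler_suml.
apply: (big_ind P) => // p _.
have := Pe ((x u : R)@_p) (p + symbol_lcm u)%MM u (lem_addl _ _).
by rewrite /strand_elt addmK scalerA mul_mpolyC.
Qed.

(** * The cone over the first divisor *)

Definition first_divisor a q : bool :=
  (tnth f q <= a)%MM &&
  [forall q' : 'I_m, (q' < q)%N ==> ~~ (tnth f q' <= a)%MM].

Lemma first_divisor_exists a i : (tnth f i <= a)%MM ->
  exists2 q, first_divisor a q & (q <= i)%N.
Proof.
move=> fi.
have [q fq qmin] := @arg_minnP _ i [pred q | (tnth f q <= a)%MM] val fi.
exists q; last exact: qmin.
rewrite /first_divisor [(_ <= _)%MM]fq; apply/forallP => q'; apply/implyP.
by apply: contraL => /qmin; rewrite -leqNgt.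
Qed.

Lemma first_divisor_le a q i : first_divisor a q -> (tnth f i <= a)%MM ->
  (q <= i)%N.
Proof.
move=> /andP[_ /forallP/(_ i)/implyP qmin] fi; rewrite leqNgt.
by apply/negP => /qmin; rewrite fi.
Qed.

Lemma first_divisor_uniq a q q' :
  first_divisor a q -> first_divisor a q' -> q = q'.
Proof.
move=> fq fq'; apply/val_inj/anti_leq.
case/andP: (fq) => fqa _; case/andP: (fq') => fqa' _.
by rewrite (first_divisor_le fq) ?(first_divisor_le fq').
Qed.

(** The image of [strand_elt a u] under the homotopy.  The partial injection
    [insub] deals with the two cases at once: if [q] is already the head of [u],
    the prepended sequence is not increasing, and the value is 0. *)
Definition cone t a (u : L_symbol f t) : L t.+1 :=
  if [pick q | first_divisor a q] is Some q then
    oapp (strand_elt a) 0 (insub [tuple of q :: val u])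
  else 0.

Lemma coneE t a q (u : L_symbol f t) : first_divisor a q ->
  cone a u = oapp (strand_elt a) 0 (insub [tuple of q :: val u]).
Proof.
move=> fq; rewrite /cone; case: pickP => [q' /(first_divisor_uniq fq) <- //|].
by move/(_ q); rewrite fq.
Qed.

Lemma cone_prepend t a q (u : L_symbol f t) (v : L_symbol f t.+1) :
  first_divisor a q -> val v = [tuple of q :: val u] ->
  cone a u = strand_elt a v.
Proof. by move=> fq vu; rewrite (coneE _ fq) -vu valK. Qed.

Lemma symbol_increasing t (u : L_symbol f t) (h k : 'I_t) : (h < k)%N ->
  (tnth (val u) h < tnth (val u) k)%N.
Proof.
by have /andP[/forallP/(_ h)/forallP/(_ k)/implyP inc _] := valP u.
Qed.

Arguments symbol_increasing [t] u [h k].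

Lemma symbol_head_tail t (u : L_symbol f t.+1) :
  val u = [tuple of tnth (val u) ord0 :: val (face ord0 u)].
Proof.
apply: eq_from_tnth => k; case: (unliftP ord0 k) => [k' ->|->].
  by rewrite tnthS tnth_mktuple.
by rewrite tnth0.
Qed.

Lemma cone_head t a (u : L_symbol f t.+1) :
  first_divisor a (tnth (val u) ord0) -> cone a u = 0.
Proof.
move=> fq; rewrite (coneE _ fq); case: insubP => // v _ vE.
have := symbol_increasing v (isT : (ord0 < lift ord0 ord0)%N).
by rewrite vE tnth0 tnthS ltnn.
Qed.

(** At the new head, admissibility holds because the lcm of the whole symbol
    divides X^a, whereas nothing before [q] does; at the other positions the
    tails are those of [u]. *)
Lemma prepend_symbol t a q (u : L_symbol f t) :
    (symbol_lcm u <= a)%MM -> first_divisor a q ->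
    (forall k, (q < tnth (val u) k)%N) ->
  exists v : L_symbol f t.+1, val v = [tuple of q :: val u].
Proof.
move=> ua fq qu; set w := [tuple of _].
suff wP : increasing w && L_admissible f w by exists (exist _ w wP).
have /andP[/forallP inc /forallP adm] := valP u.
apply/andP; split.
  apply/forallP=> h; apply/forallP=> k; apply/implyP.
  case: (unliftP ord0 k) => [k' ->|->]; last by [].
  case: (unliftP ord0 h) => [h' ->|->] hk; last by rewrite tnth0 tnthS.
  by rewrite !tnthS; apply: (symbol_increasing u).
apply/forallP=> h; apply/implyP=> ht; apply/forallP=> q'; apply/implyP.
case: (unliftP ord0 h) ht => [h' ->|->] ht.
  rewrite tnthS => qh.
  have /forallP/(_ q')/implyP/(_ qh) := implyP (adm h') ht.
  apply: contra => /lepm_trans; apply; apply/lcm_fromP => k hk.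
  case: (unliftP ord0 k) hk => [k' ->|->] // hk; rewrite tnthS.
  by have /lcm_fromP/(_ k' hk) := lepm_refl (lcm_from f (val u) h').
rewrite tnth0 => qq; have /andP[fqa /forallP/(_ q')/implyP/(_ qq)] := fq.
apply: contra => /lepm_trans; apply; apply/lcm_fromP => k _.
case: (unliftP ord0 k) => [k' ->|->]; last by rewrite tnth0.
by rewrite tnthS; move: k'; apply/symbol_lcmP.
Qed.

Lemma face0_prepend t q (u : L_symbol f t) (v : L_symbol f t.+1) :
  val v = [tuple of q :: val u] -> face ord0 v = u.
Proof.
move=> vu; apply: val_inj; apply: eq_from_tnth => k /=.
by rewrite tnth_mktuple vu tnthS.
Qed.

Lemma faceS_prepend t q (u : L_symbol f t.+1) (v : L_symbol f t.+2) j :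
  val v = [tuple of q :: val u] ->
  val (face (lift ord0 j) v) = [tuple of q :: val (face j u)].
Proof.
move=> vu; apply: eq_from_tnth => k; rewrite /= tnth_mktuple vu.
case: (unliftP ord0 k) => [k' ->|->].
  rewrite tnthS tnth_mktuple.
  have -> : lift (lift ord0 j) (lift ord0 k') = lift ord0 (lift j k').
    by apply: val_inj; rewrite /= /bump; lia.
  by rewrite tnthS.
by rewrite tnth0 (_ : lift _ _ = ord0) ?tnth0 //; apply: val_inj.
Qed.

Lemma symbol_lcm_prepend t a q (u : L_symbol f t) (v : L_symbol f t.+1) :
    (symbol_lcm u <= a)%MM -> first_divisor a q ->
    val v = [tuple of q :: val u] ->
  (symbol_lcm v <= a)%MM.
Proof.
move=> ua /andP[fq _] vu; apply/symbol_lcmP => k; rewrite vu.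
case: (unliftP ord0 k) => [k' ->|->]; last by rewrite tnth0.
by rewrite tnthS; move: k'; apply/symbol_lcmP.
Qed.

Lemma symbol_lcm0 (u : L_symbol f 0) a : (symbol_lcm u <= a)%MM.
Proof. by apply/symbol_lcmP => -[]. Qed.

Lemma L_diff_cone0 a q (u : L_symbol f 0) : first_divisor a q ->
  L_diff (cone a u) = strand_elt a u.
Proof.
move=> fq; have ua := symbol_lcm0 u a.
have [|v vu] := prepend_symbol ua fq; first by case.
rewrite (cone_prepend fq vu) L_diff_strand ?(symbol_lcm_prepend ua fq vu) //.
by rewrite big_ord1 scale1r (face0_prepend vu).
Qed.

Lemma symbol_head_le t (u : L_symbol f t.+1) k :
  (tnth (val u) ord0 <= tnth (val u) k)%N.
Proof.
case: (unliftP ord0 k) => [k' ->|->] //; apply: ltnW.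
exact: (symbol_increasing u).
Qed.

(** This is the identity d h + h d = id on a strand.  If [q] comes before the
    head of [u], face 0 of q u is [u], and its other faces are q applied to the
    faces of [u], with opposite signs.  If [q] is the head of [u], then h u = 0,
    and face 0 is the only face of [u] not starting with [q]; prepending [q] to
    it gives [u] back. *)
Lemma L_diff_cone t a (u : L_symbol f t.+1) : (symbol_lcm u <= a)%MM ->
  L_diff (cone a u)
    = strand_elt a u - \sum_(j < t.+1) (-1) ^+ j *: cone a (face j u).
Proof.
move=> ua; have [q fq] := first_divisor_exists (symbol_lcmP _ _ ua ord0).
rewrite leq_eqVlt => /predU1P[/val_inj qE | lt_qu].
  rewrite cone_head -?qE // linear0 big_ord_recl scale1r big1 ?addr0.
    have vu := symbol_head_tail u; rewrite -qE in vu.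
    by rewrite (cone_prepend fq vu) subrr.
  case: t u ua qE => [|t] u ua qE j _; first by case: j.
  rewrite cone_head ?scaler0 // tnth_mktuple.
  by rewrite (_ : lift _ _ = ord0) -?qE //; apply: val_inj.
have [|v vu] := prepend_symbol ua fq.
  by move=> k; apply: leq_trans lt_qu (symbol_head_le u k).
rewrite (cone_prepend fq vu) L_diff_strand ?(symbol_lcm_prepend ua fq vu) //.
rewrite big_ord_recl scale1r (face0_prepend vu); congr (_ + _).
rewrite -sumrN; apply: eq_bigr => j _.
by rewrite (cone_prepend fq (faceS_prepend j vu)) exprS mulN1r scaleNr.
Qed.

(** * The contracting homotopy and exactness *)

Definition homotopy t (x : L t) : L t.+1 :=
  \sum_u monomial_ext (fun p => cone (p + symbol_lcm u)%MM u) (x u : R).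

Lemma homotopy_is_additive t : zmod_morphism (@homotopy t).
Proof.
move=> x y; rewrite /homotopy -sumrB; apply: eq_bigr => u _.
by rewrite !ffunE raddfB.
Qed.

HB.instance Definition _ t := GRing.isZmodMorphism.Build (L t) (L t.+1)
  (@homotopy t) (@homotopy_is_additive t).

Lemma homotopy_strand t (c : K) a (u : L_symbol f t) : (symbol_lcm u <= a)%MM ->
  homotopy (c%:MP *: strand_elt a u) = c%:MP *: cone a u.
Proof.
move=> ua; rewrite /homotopy (bigD1 u) //= big1 ?addr0 => [|v vu].
  rewrite !ffunE eqxx [_ *: (_ *: _)]mulrA [_ * _ * _]mulr1 monomial_extX.
  by rewrite submK.
by rewrite !ffunE (negbTE vu) [_ *: (_ *: _)]mulrA mulr0 raddf0.
Qed.

Lemma homotopy_strand1 t a (u : L_symbol f t) : (symbol_lcm u <= a)%MM ->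
  homotopy (strand_elt a u) = cone a u.
Proof. by move=> /(homotopy_strand 1); rewrite mpolyC1 !scale1r. Qed.

Lemma homotopyD t (x y : L t) : homotopy (x + y) = homotopy x + homotopy y.
Proof. exact: raddfD. Qed.

Lemma homotopyP t (x : L t.+1) :
  L_diff (homotopy x) = x - homotopy (L_diff x).
Proof.
elim/strand_ind: x => [|x y hx hy|c a u ua].
- by rewrite !(raddf0, linear0) addr0.
- rewrite !(homotopyD, L_diffD) opprD addrACA.
  exact: etrans (congr2 +%R hx hy) _.
rewrite homotopy_strand // (L_diffZ _ (cone _ _)) (L_diffZ _ (strand_elt _ _)).
rewrite L_diff_cone // L_diff_strand //.
rewrite scalerBr !scaler_sumr (raddf_sum (@homotopy t)); congr (_ - _).
apply: eq_bigr => j _.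
have fa := lepm_trans (symbol_lcm_face j u) ua.
rewrite (scalerA _ _ (cone _ _)) (scalerA _ _ (strand_elt _ _)).
by rewrite -(rmorph_sign (@mpolyC n K)) -mpolyCM /= homotopy_strand.
Qed.

(** Two entries are needed: admissibility puts no condition on the last
    position, so the head of a symbol of dimension 1 need not be the first
    divisor of its lcm. *)
Lemma first_divisor_head t (u : L_symbol f t.+2) :
  first_divisor (symbol_lcm u) (tnth (val u) ord0).
Proof.
apply/andP; split; first by exact/symbol_lcmP/lepm_refl.
by have /andP[_ /forallP/(_ ord0)] := valP u.
Qed.

Lemma basis_elt_homotopy t (u : L_symbol f t.+2) :
  basis_elt K u = homotopy (strand_elt (symbol_lcm u) (face ord0 u)).
Proof.
rewrite homotopy_strand1 ?symbol_lcm_face //.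
rewrite (cone_prepend (first_divisor_head u) (symbol_head_tail u)).
by rewrite /strand_elt -{1}[symbol_lcm u]add0m addmK mpolyX0 scale1r.
Qed.

Lemma L_diff_diff_basis t :
    (forall u : L_symbol f t.+2, L_diff (L_diff (basis_elt K u)) = 0) ->
  forall x : L t.+2, L_diff (L_diff x) = 0.
Proof.
move=> dd; elim/strand_ind => [|x y dx dy|c a u _]; first by rewrite !linear0.
  by rewrite !L_diffD; apply: etrans (congr2 +%R dx dy) (addr0 _).
by rewrite /strand_elt !L_diffZ dd !scaler0.
Qed.

(** If u = h v, then d d u = d v - d h d v.  When v has dimension 1, d v lies in
    degree 0, where d h is the identity on the strand of lcm u; otherwise
    d h d v = d v - h d d v, and d d v = 0 by induction. *)
Lemma L_diff_diff t (x : L t.+2) : L_diff (L_diff x) = 0.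
Proof.
elim: t x => [|t IH]; apply: L_diff_diff_basis => u.
all: have fu := symbol_lcm_face ord0 u.
all: rewrite basis_elt_homotopy homotopyP L_diffB.
  rewrite L_diff_strand // big_ord1 scale1r homotopy_strand1 ?symbol_lcm0 //.
  by rewrite (L_diff_cone0 _ (first_divisor_head u)) subrr.
by rewrite homotopyP IH raddf0 subr0 subrr.
Qed.

Lemma L_exact t (x : L t.+1) : L_diff x = 0 <-> exists y : L t.+2, L_diff y = x.
Proof.
split=> [dx|[y <-]]; last exact: L_diff_diff.
by exists (homotopy x); rewrite homotopyP dx raddf0 subr0.
Qed.

Lemma generator_is_symbol (i : 'I_m) :
  increasing [tuple i] && L_admissible f [tuple i].
Proof.
apply/andP; split; last by apply/forallP => -[[]].
by apply/forallP => h; apply/forallP => k; rewrite !ord1.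
Qed.

Definition generator_symbol i : L_symbol f 1 :=
  exist _ [tuple i] (generator_is_symbol i).

Lemma generator_lcm i : symbol_lcm (generator_symbol i) = tnth f i.
Proof. by rewrite /symbol_lcm /lcm_from big_mkcond big_ord1 (tnth_nth i). Qed.

Lemma L_diff_generator i :
  L_diff (basis_elt K (generator_symbol i)) (empty_symbol f) = 'X_[tnth f i].
Proof.
rewrite L_diff_basis /diff_symbol big_ord1 !ffunE.
rewrite (symbol0_eq (face _ _) (empty_symbol f)) eqxx generator_lcm.
rewrite [symbol_lcm (empty_symbol f)]big_ord0 subm0 mul1r.
exact: mulr1.
Qed.

(** Single generators are always symbols, and d maps them onto the given
    generators of the ideal. *)
Lemma L_aug_exact (x : L 0) :
  L_aug x = 0 <-> exists y : L 1, L_diff y = x.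
Proof.
have L0P (y z : L 0) : y (empty_symbol f) = z (empty_symbol f) -> y = z.
  by move=> yz; apply/ffunP => u; rewrite (symbol0_eq u (empty_symbol f)).
rewrite /L_aug; split.
  rewrite -(raddf0 (class_of _)) => /class_of_eq; rewrite subr0 => /ideal_genP.
  case=> c xE; exists (\sum_i c i *: basis_elt K (generator_symbol i)).
  apply: L0P; rewrite xE.
  apply: etrans (congr1 (fun y : L 0 => y _) (L_diff_sum _)) _.
  rewrite sum_ffunE; apply: eq_bigr => i _.
  by rewrite L_diffZ ffunE L_diff_generator.
case=> y <-; rewrite -(raddf0 (class_of _)); apply/class_of_eq; rewrite subr0.
elim/strand_ind: y => [|y z hy hz|c a u _].
- by rewrite linear0 ffunE rpred0.
- by rewrite L_diffD ffunE; exact: (rpredD hy hz).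
rewrite /strand_elt !(L_diffZ, ffunE); do 2!apply: ideal_gen_mull.
have -> : u = generator_symbol (tnth (val u) ord0).
  apply: val_inj; apply: eq_from_tnth => k; rewrite !ord1.
  by rewrite [RHS](tnth_nth (tnth (val u) ord0)).
by rewrite L_diff_generator; apply: (mem_ideal_gen (fun i => 'X_[tnth f i])).
Qed.

Theorem Lyubeznik_free_resolution :
  free_resolution (F := Lyubeznik_complex K f) (Lyubeznik_aug K f).
Proof.
split=> [y|x|t x]; [|exact: L_aug_exact|exact: L_exact].
exists [ffun=> repr y]; rewrite /= /L_aug ffunE.
exact: class_of_repr.
Qed.

(** * Minimality *)

Lemma monomial_irrelevant (p : 'X_{1..n}) : p != 0%MM ->
  'X_[p] \in irrelevant_ideal K n.
Proof.
rewrite -mdeg_eq0 mdegE sum_nat_eq0 => /forallPn[i]; rewrite /= -lep1mP => pi.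
rewrite -(submK pi) mpolyXD; apply: ideal_gen_mull.
exact: (mem_ideal_gen (fun i => 'X_i)).
Qed.

(** If the lcm of a face were that of the symbol, it would be divisible by the
    omitted generator. *)
Lemma Lyubeznik_minimal :
    (forall t (u : L_symbol f t.+1) j,
       ~~ (tnth f (tnth (val u) j) <= symbol_lcm (face j u))%MM) ->
  minimal_wrt (irrelevant_ideal K n) (Lyubeznik_complex K f).
Proof.
move=> fmin t x; exists #|L_symbol f t|.
exists (fun i => (L_diff x) (enum_val i)), (fun i => basis_elt K (enum_val i)).
split=> [i|]; last first.
  apply: etrans (L_module_sum (L_diff x)) _.
  exact: (reindex _ (onW_bij _ (@enum_val_bij _))).
move: (enum_val i) => v; rewrite /L_diff sum_ffunE; apply: rpred_sum => u _.
rewrite ffunE; apply: ideal_gen_mull.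
rewrite /diff_symbol sum_ffunE; apply: rpred_sum => j _.
rewrite !ffunE [_ *: _]mulrC; do 2!apply: ideal_gen_mull.
apply: monomial_irrelevant; apply: contra (fmin t u j) => /eqP uj.
have <- : symbol_lcm u = symbol_lcm (face j u).
  by rewrite -(submK (symbol_lcm_face j u)) uj add0m.
exact/symbol_lcmP/lepm_refl.
Qed.

End Strands.
Arguments symbol_increasing {n m f t} u {h k}.

(** * The edges of the double star *)

Section DoubleStarEdges.
Variables r s : nat.
Local Notation E := (double_star_edges r s).

Variant double_star_edge_spec (i : nat) : 'X_{1..2 + r + s} -> Prop :=
| EdgeAB of i = 0%N : double_star_edge_spec i (U_(var_a r s) + U_(var_b r s))%MM
| EdgeAX (k : 'I_r) of i = k.+1 :> nat :
    double_star_edge_spec i (U_(var_a r s) + U_(var_x s k))%MM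
| EdgeBY (k : 'I_s) of i = (1 + r + k)%N :> nat :
    double_star_edge_spec i (U_(var_b r s) + U_(var_y r k))%MM.

Lemma double_star_edgeP (i : 'I_(1 + r + s)) :
  double_star_edge_spec i (tnth E i).
Proof.
case: i => [[|i] lti]; rewrite (tnth_nth 0%MM) /=; first by constructor.
rewrite nth_cat size_map size_enum_ord; case: ltnP => hi.
  rewrite -[i]/(val (Ordinal hi)) (nth_mktuple _ _ (Ordinal hi)).
  by constructor.
have hj : (i - r < s)%N by move: lti hi; lia.
rewrite -[(i - r)%N]/(val (Ordinal hj)) (nth_mktuple _ _ (Ordinal hj)).
by constructor; rewrite /=; lia.
Qed.

Lemma leaf_variable (i : 'I_(1 + r + s)) : (0 < i)%N ->
  exists2 v, tnth E i v != 0%N & forall k, k != i -> tnth E k v = 0%N.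
Proof.
case: double_star_edgeP => [->//|l il|l il] _;
  [exists (var_x s l)|exists (var_y r l)];
  rewrite ?(mnmDE, mnm1E) -?val_eqE /=; try lia.
all: move=> k ki; have {}ki : k <> i :> nat by move=> /val_inj/eqP; apply/negP.
all: case: double_star_edgeP => [k0|l' kl|l' kl].
all: by rewrite !(mnmDE, mnm1E) -!val_eqE /=; have := ltn_ord l; lia.
Qed.

Lemma central_edge : tnth E ord0 = (U_(var_a r s) + U_(var_b r s))%MM.
Proof. by case: double_star_edgeP. Qed.

Lemma central_edge_not_le (i : 'I_(1 + r + s)) : (0 < i)%N ->
  ~~ (tnth E ord0 <= tnth E i)%MM.
Proof.
rewrite central_edge.
case: double_star_edgeP => [->//|l _|l _] _; apply/mnm_lepP;
  [move/(_ (var_b r s))|move/(_ (var_a r s))];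
  rewrite !(mnmDE, mnm1E) -?val_eqE /=; lia.
Qed.

(** The omitted generator is either a leaf edge, whose leaf occurs in no other
    generator, or ab, which is then the head; the latter case depends on the
    number of remaining generators. *)
Lemma double_star_not_le t (u : L_symbol E t.+1) j :
  ~~ (tnth E (tnth (val u) j) <= symbol_lcm (face j u))%MM.
Proof.
have [uj0|uj0] := posnP (tnth (val u) j); last first.
  have [v uv kv] := leaf_variable uj0; apply/mnm_lepP => /(_ v).
  rewrite symbol_lcm_avoid ?leqn0 ?(negbTE uv) // => k.
  rewrite tnth_mktuple; apply: kv; apply/eqP => ukj.
  have := neq_lift j k; rewrite -val_eqE neq_ltn.
  by case/orP => /(symbol_increasing u); rewrite ukj ltnn.
have j0 : j = ord0.
  case: (unliftP ord0 j) uj0 => [j' ->|->] // uj0.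
  by have := symbol_increasing u (isT : (ord0 < lift ord0 j')%N); rewrite uj0.
have {uj0} -> : tnth (val u) j = ord0 by apply: val_inj.
rewrite {j}j0; have u1 k : (0 < tnth (val u) (lift ord0 k))%N.
  apply: leq_ltn_trans (leq0n _) _.
  exact: (symbol_increasing u (isT : (ord0 < lift ord0 k)%N)).
case: t u u1 => [|[|t]] u u1.
- apply/mnm_lepP => /(_ (var_a r s)).
  rewrite symbol_lcm_avoid; last by case.
  by rewrite central_edge mnmDE mnm1E eqxx.
- apply: contra (central_edge_not_le (u1 ord0)) => /lepm_trans; apply.
  by apply/symbol_lcmP => k; rewrite (ord1 k) tnth_mktuple; apply: lepm_refl.
(* With two or more generators left, the second position is not the last one,
   and admissibility there, tested on ab, is the claim. *)
have /andP[_ /forallP/(_ (lift ord0 ord0))] := valP u.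
move=> /forallP/(_ ord0)/implyP/(_ (u1 _)).
apply: contra => /lepm_trans; apply; apply/symbol_lcmP => k.
rewrite tnth_mktuple.
by have /lcm_fromP := lepm_refl (lcm_from E (val u) 1); apply.
Qed.

End DoubleStarEdges.

Theorem proposition7 (K : fieldType) (r s : nat) :
  minimal_free_resolution
    (irrelevant_ideal K (2 + r + s))
    (F := Lyubeznik_complex K (double_star_edges r s))
    (M := monomial_quotient K (double_star_edges r s))
    (Lyubeznik_aug K (double_star_edges r s)).
Proof.
split; first exact: Lyubeznik_free_resolution.
by apply: Lyubeznik_minimal => t u j; apply: double_star_not_le.
Qed.
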